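(* Let $p>3$ be a prime. Then $$T_{p-1}\equiv\left(\frac p3\right)3^{p-1}\pmod{p^2}$$ and $$\sum_{k=0}^{p-1}\binom{p-1}{k}\binom{2k}{k}\left((-1)^k-(-3)^{-k}\right)\equiv\left(\frac p3\right)(3^{p-1}-1)\pmod{p^3}.$$
   Context: For $n\in\mathbb N=\{0,1,2,\dots\}$, the central trinomial coefficient $T_n$ is the constant term in the expansion of $(1+x+x^{-1})^n$; equivalently $T_n=\sum_{j=0}^{\lfloor n/2\rfloor}\binom{n}{j}\binom{n-j}{j}$. $\left(\frac{\cdot}{3}\right)$ denotes the Legendre symbol modulo $3$. Congruences between rational numbers whose denominators are prime to $p$ are understood in the ring of $p$-integral rationals. *)

(* Defs.v *)
From HB Require Import structures.
From mathcomp Require Import all_boot all_order all_algebra.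
From mathcomp Require Import zify.

Set Implicit Arguments.
Unset Strict Implicit.
Unset Printing Implicit Defensive.

Import Order.TTheory GRing.Theory Num.Theory.
Local Open Scope ring_scope.

(* The constant term of (1 + x + x^-1)^n = x^-n (1 + x + x^2)^n is the
   coefficient of x^n in (1 + x + x^2)^n; see [trinomial_laurent] and
   [central_trinomialE]. *)
Definition central_trinomial (n : nat) : int :=
  ((1 + 'X + 'X^2 : {poly int}) ^+ n)`_n.

Lemma trinomial_laurent (n : nat) :
  let x : {fraction {poly int}} := FracField.tofrac 'X in
  (1 + x + x^-1) ^+ n =
    x ^- n * \sum_(i < n.*2.+1)
               (((1 + 'X + 'X^2 : {poly int}) ^+ n)`_i)%:~R * x ^+ i.
Proof.
move=> x; have x0 : x != 0 by rewrite tofrac_eq0 polyX_eq0.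
have -> : 1 + x + x^-1 = x^-1 * (1 + x + x ^+ 2).
  by rewrite !mulrDr mulr1 mulVf // expr2 mulrA mulVf // mul1r addrC addrA.
rewrite exprMn exprVn; congr (_ * _).
set q := (1 + 'X + 'X^2 : {poly int}).
have -> : 1 + x + x ^+ 2 = FracField.tofrac q.
  by rewrite !rmorphD rmorph1 rmorphXn.
have sq : (size q <= 3)%N.
  rewrite (leq_trans (size_polyD _ _)) // geq_max size_polyXn leqnn andbT.
  rewrite (leq_trans (size_polyD _ _)) // geq_max size_poly1 size_polyX //.
have sqn : (size (q ^+ n) <= n.*2.+1)%N.
  apply: leq_trans (size_poly_exp_leq _ _) _.
  rewrite ltnS -mul2n leq_mul2r; apply/orP; right.
  by case: (size q) sq.
rewrite -rmorphXn -[in LHS](coefK (q ^+ n)) poly_def rmorph_sum /=.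
rewrite (big_ord_widen _ (fun i => FracField.tofrac ((q ^+ n)`_i *: 'X^i)) sqn).
rewrite big_mkcond /=; apply: eq_bigr => i _.
case: ltnP => [_|le]; last by rewrite nth_default // mul0r.
by rewrite -[in LHS](intz (q ^+ n)`_i) scaler_int rmorphMz rmorphXn mulrzl.
Qed.

Lemma central_trinomialE (n : nat) :
  central_trinomial n =
    (\sum_(j < n./2.+1) 'C(n, j) * 'C(n - j, j))%N%:Z.
Proof.
rewrite /central_trinomial.
have -> : 1 + 'X + 'X^2 = 'X * ('X + 1) + 1 :> {poly int}.
  by rewrite mulrDr mulr1 -expr2 -addrA addrC ['X + _]addrC.
rewrite exprDn coef_sum.
pose F j := ('C(n, j) * 'C(n - j, j))%N.
have -> : (\sum_(j < n./2.+1) 'C(n, j) * 'C(n - j, j) = \sum_(j < n.+1) F j)%N.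
  have le : (n./2.+1 <= n.+1)%N by lia.
  rewrite (big_ord_widen _ F le) big_mkcond; apply: eq_bigr => j _.
  by case: ltnP => // lt; rewrite /F ['C(n - j, j)]bin_small ?muln0 //; lia.
rewrite -natz natr_sum; apply: eq_bigr => j _.
have lej : (j <= n)%N by have := ltn_ord j; lia.
rewrite coefMn expr1n mulr1 exprMn coefXnM ltnNge leq_subr /= subKn //.
rewrite exprDn coef_sum.
have -> : \sum_(i < (n - j).+1) ('X ^+ (n - j - i) * 1 ^+ i *+ 'C(n - j, i))`_j
        = ('C(n - j, j))%:R :> int.
  under eq_bigr => i _ do rewrite expr1n mulr1 coefMn coefXn.
  case: (ltnP (n - j) j) => h.
    rewrite bin_small // big1 // => i _; case: eqP => [e|_]; last by rewrite mul0rn.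
    by lia.
  have hk : (n - j - j < (n - j).+1)%N by lia.
  rewrite (bigD1 (Ordinal hk)) //= subKn // eqxx big1 ?addr0 => [|i ne].
    by rewrite bin_sub.
  case: eqP => [e|_]; last by rewrite mul0rn.
  by case/eqP: ne; apply: val_inj => /=; have := ltn_ord i; lia.
by rewrite /F mulnC natrM mulr_natr.
Qed.

Definition legendre (a : int) (q : nat) : int :=
  if (q%:Z %| a)%Z then 0
  else if [exists x : 'I_q, (x%:Z ^+ 2 == a %[mod q%:Z])%Z] then 1
  else -1.

Definition p_integral (p : nat) (x : rat) : bool := coprime p `|denq x|%N.

(* Congruence modulo p^m in the ring Z_(p) of p-integral rationals. *)
Definition congr_pint (p m : nat) (x y : rat) : Prop :=
  [/\ p_integral p x, p_integral p y &
      exists2 z : rat, p_integral p z & x - y = (p%:R ^+ m) * z].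

(* Main.v *)
Require Import Defs.
From mathcomp Require Import all_boot all_order all_algebra.
From mathcomp Require Import all_field zify ring.

Set Implicit Arguments.
Unset Strict Implicit.
Unset Printing Implicit Defensive.

Import Order.TTheory GRing.Theory Num.Theory.
Local Open Scope ring_scope.

(** Let [v] be a primitive cube root of unity, [n = p - 1] and [e = (p/3)].
    Since [1 + x + x^2 = (x - v) (x - v^2)], the coefficient [T_n] is
    [\sum_k C(n,k)^2 v^(n+k)], while [\sum_k v^(n+k) = e] and
    [\sum_k (-1)^k C(n,k) v^(n+k) = (v - v^2)^n = (-3)^(n/2)], called [a] below.
    As [C(n,k) = (-1)^k] modulo [p], this gives [a = e] modulo [p], and
    [T_n - 2 a + e = \sum_k (C(n,k) - (-1)^k)^2 v^(n+k)] vanishes modulo [p^2].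
    So does [e (a - e)^2 = e a^2 - 2 a + e], whence [T_n = e a^2 = e 3^n].
    For the second congruence, the decompositions
    [1 + x + 1/x = (x + 2 + 1/x) - 1 = (x - 2 + 1/x) + 3] show that the sum is
    exactly [T_n - T_n / 3^n = T_n (3^n - 1) / 3^n]. *)

Section PolynomialCoefficients.

Variable R : comNzRingType.
Implicit Types (a b c s : R) (m n k : nat).

Lemma coef_XaddC_exp a m k : (('X + a%:P) ^+ m)`_k = a ^+ (m - k) *+ 'C(m, k).
Proof.
rewrite addrC exprDn coef_sum.
under eq_bigr => i _ do rewrite coefMn -rmorphXn mul_polyC coefZ coefXn.
have [le_km|lt_mk] := leqP k m; last first.
  rewrite bin_small // big1 // => i _.
  by case: eqP => [eq_ki|_]; [have := ltn_ord i; lia | rewrite mulr0 mul0rn].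
rewrite (bigD1 (Ordinal (le_km : k < m.+1)%N)) //= eqxx mulr1.
rewrite big1 ?addr0 // => i.
by rewrite -val_eqE /= eq_sym => /negbTE->; rewrite mulr0 mul0rn.
Qed.

Lemma coef_XaddC_exp_mul a b n :
  (('X + a%:P) ^+ n * ('X + b%:P) ^+ n)`_n =
  \sum_(k < n.+1) 'C(n, k)%:R ^+ 2 * (a ^+ (n - k) * b ^+ k).
Proof.
rewrite coefM; apply: eq_bigr => k _.
have le_kn : (k <= n)%N by rewrite -ltnS.
rewrite !coef_XaddC_exp bin_sub // subKn //.
by rewrite -![_ ^+ _ *+ _]mulr_natr; ring.
Qed.

Lemma coef_scaleX_add_sqr_exp c s n :
  ((c *: 'X + ('X + s%:P) ^+ 2) ^+ n)`_n =
  \sum_(k < n.+1) 'C(n, k)%:R * 'C(2 * k, k)%:R * (c ^+ (n - k) * s ^+ k).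
Proof.
rewrite exprDn coef_sum; apply: eq_bigr => k _.
have le_kn : (k <= n)%N by rewrite -ltnS.
rewrite coefMn exprZn -scalerAl coefZ coefXnM ltnNge leq_subr /= subKn //.
rewrite -exprM coef_XaddC_exp mul2n -addnn addnK.
by rewrite -![_ ^+ _ *+ _]mulr_natr -[_ *+ 'C(n, k)]mulr_natr; ring.
Qed.

Lemma intr_central_trinomial n :
  (central_trinomial n)%:~R = ((1 + 'X + 'X^2 : {poly R}) ^+ n)`_n.
Proof.
rewrite /central_trinomial -coef_map /=; congr _`_n.
by rewrite rmorphXn !rmorphD rmorph1 /= map_polyXn map_polyX.
Qed.

Lemma central_trinomial_sqr1 c s n : s ^+ 2 = 1 -> c + 2 * s = 1 ->
  (central_trinomial n)%:~R =
  \sum_(k < n.+1) 'C(n, k)%:R * 'C(2 * k, k)%:R * (c ^+ (n - k) * s ^+ k).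
Proof.
move=> sqr_s cDs; rewrite intr_central_trinomial -coef_scaleX_add_sqr_exp.
have sqr_sP : s%:P ^+ 2 = 1 :> {poly R} by rewrite -rmorphXn sqr_s.
have cP : c%:P = 1 - 2 * s%:P :> {poly R}.
  by rewrite -(addrK (2 * s) c) cDs rmorphB rmorphM rmorph_nat.
suff -> : 1 + 'X + 'X^2 = c *: 'X + ('X + s%:P) ^+ 2 :> {poly R} by [].
by rewrite -mul_polyC cP; ring: sqr_sP.
Qed.

End PolynomialCoefficients.

Lemma sum_bin_central_bin (F : fieldType) (c s : F) (n : nat) :
    s ^+ 2 = 1 -> c + 2 * s = 1 -> c != 0 ->
  \sum_(k < n.+1) 'C(n, k)%:R * 'C(2 * k, k)%:R * (s / c) ^+ k =
  (central_trinomial n)%:~R / c ^+ n.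
Proof.
move=> sqr_s cDs c_neq0; rewrite (@central_trinomial_sqr1 _ c s) // mulr_suml.
apply: eq_bigr => k _; have le_kn : (k <= n)%N by rewrite -ltnS.
rewrite expr_div_n expfB_cond ?(negbTE c_neq0) //.
by field; rewrite !expf_neq0.
Qed.

Lemma sum_bin_central_bin_sub (F : fieldType) (n : nat) :
    ~~ odd n -> 3 != 0 :> F ->
  \sum_(k < n.+1) 'C(n, k)%:R * 'C(2 * k, k)%:R * ((-1) ^+ k - (-3) ^- k) =
  (central_trinomial n * (3 ^+ n - 1))%:~R / (3 ^+ n)%:~R :> F.
Proof.
move=> even_n three_neq0.
have sqrN1 : (-1) ^+ 2 = 1 :> F by rewrite sqrrN expr1n.
have sum_alternating :
    \sum_(k < n.+1) 'C(n, k)%:R * 'C(2 * k, k)%:R * (-1) ^+ k =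
    (central_trinomial n)%:~R :> F.
  have sgn_n : (-1) ^+ n = 1 :> F by rewrite -signr_odd (negbTE even_n).
  have cDs : -1 + 2 * 1 = 1 :> F by ring.
  have := @sum_bin_central_bin _ (-1) 1 n (expr1n _ _) cDs.
  by rewrite oppr_eq0 oner_eq0 mul1r invrN1 sgn_n divr1; apply.
have sum_inv_pow3 :
    \sum_(k < n.+1) 'C(n, k)%:R * 'C(2 * k, k)%:R * (-3) ^- k =
    (central_trinomial n)%:~R / 3 ^+ n :> F.
  rewrite -(@sum_bin_central_bin _ 3 (-1)) //; last by ring.
  by apply: eq_bigr => k _; rewrite mulN1r -invrN exprVn.
under eq_bigr => k _ do rewrite mulrBr.
rewrite sumrB sum_alternating sum_inv_pow3.
rewrite rmorphM rmorphB !rmorphXn rmorph1 !rmorph_nat /=.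
by field; rewrite expf_neq0.
Qed.

Lemma legendre3E (a : nat) :
  legendre a%:Z 3 = if (a %% 3 == 0)%N then 0
                    else if (a %% 3 == 1)%N then 1 else -1.
Proof.
rewrite /legendre dvdzE !absz_nat /dvdn; case: ifP => // a_mod3.
have sqr_mod3 (x : nat) :
    (x%:Z ^+ 2 == a %[mod 3%:Z])%Z = ((x ^ 2) %% 3 == a %% 3)%N.
  by rewrite expr2 -PoszM !modz_nat.
suff -> : [exists x : 'I_3, (x%:Z ^+ 2 == a%:Z %[mod 3%:Z])%Z] =
    (a %% 3 == 1)%N by [].
apply/existsP/eqP => [[[[|[|[|//]]] lt_x3]]|a_mod3_1]; rewrite ?sqr_mod3.
- by rewrite eq_sym a_mod3.
- by move/eqP <-.
- by move/eqP <-.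
- by exists (@Ordinal 3 1 isT); rewrite sqr_mod3 a_mod3_1.
Qed.

Lemma legendre_sqr (a : int) (q : nat) :
  ~~ (q%:Z %| a)%Z -> legendre a q ^+ 2 = 1.
Proof. by rewrite /legendre => /negbTE->; case: ifP. Qed.

Section CubeRootOfUnity.

Variables (R : comNzRingType) (v : R).
Hypothesis sum_pow_v : 1 + v + v ^+ 2 = 0.

Let sqr_v : v ^+ 2 = - 1 - v.
Proof. by rewrite -[LHS](addKr (1 + v)) sum_pow_v; ring. Qed.

Lemma cube_root_expr3 : v ^+ 3 = 1.
Proof. by ring: sqr_v. Qed.

Lemma trinomial_cube_root_factor :
  1 + 'X + 'X^2 = ('X + (- v)%:P) * ('X + (- v ^+ 2)%:P) :> {poly R}.
Proof.
have sqr_vP : v%:P ^+ 2 = - 1 - v%:P :> {poly R}.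
  by rewrite -rmorphXn sqr_v rmorphB rmorphN1.
by rewrite !(rmorphN, rmorphXn) /=; ring: sqr_vP.
Qed.

Lemma central_trinomial_cube_root (n : nat) :
  (central_trinomial n)%:~R =
  (-1) ^+ n * \sum_(k < n.+1) 'C(n, k)%:R ^+ 2 * v ^+ (n + k).
Proof.
rewrite intr_central_trinomial trinomial_cube_root_factor exprMn.
rewrite coef_XaddC_exp_mul mulr_sumr; apply: eq_bigr => k _.
have le_kn : (k <= n)%N by rewrite -ltnS.
have -> : (n + k = n - k + 2 * k)%N by lia.
have -> : (-1) ^+ n = (-1) ^+ (n - k) * (-1) ^+ k :> R by rewrite -exprD subnK.
by rewrite (exprNn v) (exprNn (v ^+ 2)) -[v ^+ 2 ^+ k]exprM exprD; ring.
Qed.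

Lemma expN3_cube_root (m : nat) :
  (-3) ^+ m =
  \sum_(k < (2 * m).+1) (-1) ^+ k * 'C(2 * m, k)%:R * v ^+ (2 * m + k).
Proof.
transitivity ((v * (1 - v)) ^+ (2 * m)).
  by rewrite exprM; congr (_ ^+ _); ring: sqr_v.
rewrite exprMn exprBn mulr_sumr; apply: eq_bigr => k _.
by rewrite expr1n -mulr_natr exprD; ring.
Qed.

Lemma legendre3_cube_root (n : nat) :
  (legendre n 3)%:~R = \sum_(k < n) v ^+ (n.-1 + k).
Proof.
case: n => [|n] /=; first by rewrite legendre3E big_ord0.
have [m] := ubnP n; elim: m n => // m IHm [|[|[|n]]] lt_nm;
  rewrite legendre3E /=.
- by rewrite big_ord_recl big_ord0 addr0.
- by rewrite !big_ord_recl big_ord0 /=; ring: sqr_v.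
- by rewrite !big_ord_recl big_ord0 /=; ring: sqr_v.
have -> : (n.+4 = 1 * 3 + n.+1)%N by lia.
rewrite modnMDl -legendre3E IHm; last by lia.
have shift3 k : v ^+ (n.+3 + k) = v ^+ (n + k).
  by rewrite -[n.+3]addn3 addnAC exprD cube_root_expr3 mulr1.
under [RHS]eq_bigr => k _ do rewrite shift3.
by rewrite 3![in RHS]big_ord_recr /= !addnS !exprS; ring: sqr_v.
Qed.

End CubeRootOfUnity.

Lemma cube_root_Aint_exists : exists2 v : algC, 1 + v + v ^+ 2 = 0 & v \in Aint.
Proof.
have [v prim_v] := C_prim_root_exists (isT : (0 < 3)%N).
exists v; last exact: Aint_prim_root prim_v.
have v_neq1 : v - 1 != 0.
  by rewrite subr_eq0 -[v]expr1 -(prim_order_dvd prim_v).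
apply: (mulfI v_neq1); rewrite mulr0.
by have cube_v := prim_expr_order prim_v; ring: cube_v.
Qed.

Lemma dvdz_sum_Aint (I : finType) (d m : int) (c : I -> int) (w : I -> algC) :
    (forall i, (d %| c i)%Z) -> (forall i, w i \in Aint) ->
  m%:~R = \sum_i (c i)%:~R * w i -> (d %| m)%Z.
Proof.
move=> dvd_c Aint_w m_sum.
have /dvdCP[_ /intrP[q ->] m_qd] : (d%:~R %| m%:~R)%C.
  rewrite -eqAmod0_rat ?rpred_int // eqAmod0 m_sum.
  apply: rpred_sum => i _; have /dvdzP[q ->] := dvd_c i.
  by rewrite rmorphM mulrAC -eqAmod0 eqAmodMl0 // rpredM ?Aint_int.
by apply/dvdzP; exists q; apply: (@intr_inj algC); rewrite m_qd rmorphM.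
Qed.

Lemma bin_prime_pred (p k : nat) : prime p -> (k < p)%N ->
  ('C(p.-1, k)%:Z == (-1) ^+ k %[mod p%:Z])%Z.
Proof.
move=> p_prime; rewrite eqz_mod_dvd.
elim: k => [|k IHk] lt_kp; first by rewrite bin0 subrr dvdz0.
have : (p%:Z %| 'C(p, k.+1)%:Z)%Z by apply: prime_dvd_bin; rewrite // lt_kp.
rewrite -[in 'C(p, _)](prednK (prime_gt0 p_prime)) binS PoszD => dvd_bin.
have -> : 'C(p.-1, k.+1)%:Z - (-1) ^+ k.+1 =
    ('C(p.-1, k.+1)%:Z + 'C(p.-1, k)%:Z) - ('C(p.-1, k)%:Z - (-1) ^+ k).
  by rewrite exprS; ring.
by rewrite rpredB // IHk // ltnW.
Qed.

Lemma prime_gt2_odd (p : nat) : prime p -> (2 < p)%N -> odd p.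
Proof. by move=> p_prime; have [->|] := even_prime p_prime. Qed.

Section OddPrime.

Variable p : nat.
Hypotheses (p_prime : prime p) (p_odd : odd p).

Let pred_p_double : p.-1 = (2 * p.-1./2)%N.
Proof. by lia. Qed.

(* Euler's criterion for [-3], combined with reciprocity [(-3/p) = (p/3)]. *)
Lemma expN3_half_pred_prime :
  ((-3) ^+ p.-1./2 == legendre p%:Z 3 %[mod p%:Z])%Z.
Proof.
have p_gt0 := prime_gt0 p_prime.
have [v sum_pow_v Aint_v] := cube_root_Aint_exists; rewrite eqz_mod_dvd.
apply: (@dvdz_sum_Aint _ _ _
    (fun k : 'I_p => (-1) ^+ k * ('C(p.-1, k)%:Z - (-1) ^+ k))
    (fun k => v ^+ (p.-1 + k))) => [k|k|].
- by rewrite dvdz_mull // -eqz_mod_dvd bin_prime_pred.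
- exact: rpredX.
rewrite rmorphB rmorphXn /= (expN3_cube_root sum_pow_v) -pred_p_double.
rewrite (legendre3_cube_root sum_pow_v) prednK // -sumrB.
apply: eq_bigr => k _; rewrite rmorphM rmorphB rmorphXn rmorphN1 /=.
by rewrite mulrBr -expr2 sqrr_sign; ring.
Qed.

Lemma central_trinomial_pred_prime_linear :
  (central_trinomial p.-1 == 2 * (-3) ^+ p.-1./2 - legendre p%:Z 3
     %[mod p%:Z ^+ 2])%Z.
Proof.
have p_gt0 := prime_gt0 p_prime.
have [v sum_pow_v Aint_v] := cube_root_Aint_exists; rewrite eqz_mod_dvd.
apply: (@dvdz_sum_Aint _ _ _
    (fun k : 'I_p => ('C(p.-1, k)%:Z - (-1) ^+ k) ^+ 2)
    (fun k => v ^+ (p.-1 + k))) => [k|k|].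
- by rewrite dvdz_exp2r // -eqz_mod_dvd bin_prime_pred.
- exact: rpredX.
have sgn_pred : (-1) ^+ p.-1 = 1 :> algC.
  by rewrite pred_p_double exprM sqrrN !expr1n.
rewrite !rmorphB rmorphM rmorphXn /= (expN3_cube_root sum_pow_v) -pred_p_double.
rewrite (central_trinomial_cube_root sum_pow_v) sgn_pred mul1r.
rewrite (legendre3_cube_root sum_pow_v) prednK // mulr_sumr -!sumrB.
apply: eq_bigr => k _; rewrite rmorphXn rmorphB rmorphXn rmorphN1 /=.
have sqr_sgn : (-1) ^+ k ^+ 2 = 1 :> algC := sqrr_sign _ _.
by ring: sqr_sgn.
Qed.

Lemma expN3_half_pred_sqr : ((-3) ^+ p.-1./2) ^+ 2 = 3 ^+ p.-1 :> int.
Proof. by rewrite exprAC sqrrN -exprM -pred_p_double. Qed.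

End OddPrime.

Section PrimeGt3.

Variable p : nat.
Hypotheses (p_prime : prime p) (p_gt3 : (3 < p)%N).

Let p_odd : odd p.
Proof. by rewrite prime_gt2_odd ?(ltnW p_gt3). Qed.

Let legendre_p3_sqr : legendre p%:Z 3 ^+ 2 = 1.
Proof.
rewrite legendre_sqr // dvdzE -prime_coprime // coprime_sym.
by rewrite prime_coprime // gtnNdvd.
Qed.

Lemma exp3_pred_prime : (3 ^+ p.-1 == 1 %[mod p%:Z])%Z.
Proof.
rewrite eqz_mod_dvd -expN3_half_pred_sqr // -[X in _ - X]legendre_p3_sqr.
by rewrite subr_sqr dvdz_mulr // -eqz_mod_dvd expN3_half_pred_prime.
Qed.

Lemma central_trinomial_pred_prime :
  (central_trinomial p.-1 == legendre p%:Z 3 * 3 ^+ p.-1 %[mod p%:Z ^+ 2])%Z.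
Proof.
have := central_trinomial_pred_prime_linear p_prime p_odd.
have := expN3_half_pred_prime p_prime p_odd.
rewrite -expN3_half_pred_sqr // !eqz_mod_dvd.
set T := central_trinomial _; set a := (-3) ^+ _.
move: legendre_p3_sqr; set e := legendre _ _ => sqr_e dvd_ae dvd_T.
have -> : T - e * a ^+ 2 =
    (T - (2 * a - e)) - e * (a - e) ^+ 2 + (e ^+ 2 - 1) * (e - 2 * a) by ring.
by rewrite sqr_e subrr mul0r addr0 rpredB // dvdz_mull // dvdz_exp2r.
Qed.

End PrimeGt3.

Lemma p_integral_div (p : nat) (n d : int) :
  coprime p `|d|%N -> p_integral p (n%:~R / d%:~R).
Proof.
rewrite /p_integral; case: divqP => [_|k x _]; first by rewrite coprimen1.
by rewrite abszM coprimeMr => /andP[].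
Qed.

Lemma congr_pint_div (p m : nat) (a b d : int) :
    d != 0 -> coprime p `|d|%N -> (p%:Z ^+ m %| a - b * d)%Z ->
  congr_pint p m (a%:~R / d%:~R) b%:~R.
Proof.
move=> d_neq0 co_pd /dvdzP[q abd]; split; first exact: p_integral_div.
  by rewrite /p_integral denq_int coprimen1.
exists (q%:~R / d%:~R); first exact: p_integral_div.
have dQ_neq0 : d%:~R != 0 :> rat by rewrite intr_eq0.
apply: (mulIf dQ_neq0); rewrite mulrBl mulrA !divfK // [RHS]mulrC.
by have := congr1 (intr : int -> rat) abd; rewrite rmorphB !rmorphM rmorphXn.
Qed.

Theorem theorem1p1 (p : nat) (p_prime : prime p) (p_gt3 : (3 < p)%N) :
  (central_trinomial p.-1 = legendre p%:Z 3 * 3%:Z ^+ p.-1 %[mod p%:Z ^+ 2])%Z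
  /\
  congr_pint p 3
    (\sum_(0 <= k < p)
       'C(p.-1, k)%:R * 'C(2 * k, k)%:R * ((-1) ^+ k - (-3%:R) ^- k))
    ((legendre p%:Z 3)%:~R * (3%:R ^+ p.-1 - 1)).
Proof.
have T_mod := central_trinomial_pred_prime p_prime p_gt3.
split; first exact/eqP.
have even_n : ~~ odd p.-1.
  by have := prime_gt2_odd p_prime (ltnW p_gt3); lia.
have := @sum_bin_central_bin_sub rat _ even_n isT.
rewrite big_mkord prednK ?prime_gt0 // => ->.
have -> : (legendre p%:Z 3)%:~R * (3%:R ^+ p.-1 - 1) =
    (legendre p%:Z 3 * (3 ^+ p.-1 - 1))%:~R :> rat.
  by rewrite rmorphM rmorphB rmorphXn.
apply: congr_pint_div; first by rewrite expf_neq0.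
  by rewrite abszX coprimeXr // prime_coprime // gtnNdvd.
rewrite -mulrA [_ * 3 ^+ _]mulrC mulrA -mulrBl exprSr.
by rewrite dvdz_mul // -eqz_mod_dvd // exp3_pred_prime.
Qed.
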